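(* A matroid is laminar if and only if it has no minor isomorphic to any member of $\{Y_r : r\ge 3\}$.
   Context: All matroids are finite. A family $\mathcal{A}$ of subsets of a finite set $E$ is laminar if, for all $A,B\in\mathcal{A}$ with $A\cap B\neq\emptyset$, either $A\subseteq B$ or $B\subseteq A$. Given a laminar family $\mathcal{A}$ of subsets of $E$ and a capacity function $c:\mathcal{A}\to\mathbb{Z}_{\ge 0}$, $M(E,\mathcal{A},c)$ is the matroid on $E$ whose independent sets are exactly the sets $I\subseteq E$ with $|I\cap A|\le c(A)$ for all $A\in\mathcal{A}$. A matroid is laminar if it is isomorphic to $M(E,\mathcal{A},c)$ for some finite set $E$, laminar family $\mathcal{A}$ of subsets of $E$, and capacity function $c$. For each integer $r\ge 3$, $Y_r$ is the matroid obtained by truncating, to rank $r$, the parallel connection (across one common basepoint) of two $r$-element circuits $U_{r-1,r}$. The truncation of a matroid $N$ to rank $r\le r(N)$ is the matroid on $E(N)$ whose independent sets are the independent sets of $N$ of size at most $r$. *)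

(* Defs.v *)
From mathcomp Require Import all_boot zify.

Set Implicit Arguments.
Unset Strict Implicit.
Unset Printing Implicit Defensive.

Definition matroid_axioms (T : finType) (E : {set T}) (F : {set {set T}}) :
    Prop :=
  [/\ forall I, I \in F -> I \subset E,
      set0 \in F,
      forall I J : {set T}, J \in F -> I \subset J -> I \in F
    & forall I J : {set T}, I \in F -> J \in F -> #|I| < #|J| ->
        exists2 x, x \in J :\: I & x |: I \in F].

(* The ground set is a subset of the carrier type, so that a minor of a      *)
(* matroid lives on the same type.                                           *)
Record matroid (T : finType) := Matroid {
  ground : {set T};
  indep : {set {set T}};
  matroidP : matroid_axioms ground indep
}.

Definition isomorphic (T T' : finType) (M : matroid T) (N : matroid T') :
    Prop :=
  exists2 f : {x : T | x \in ground M} -> {y : T' | y \in ground N},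
    bijective f &
    forall I : {set {x : T | x \in ground M}},
      ([set val x | x in I] \in indep M) =
      ([set val y | y in [set f x | x in I]] \in indep N).

Definition circuits (T : finType) (M : matroid T) : {set {set T}} :=
  [set C | minset (fun X : {set T} => (X \subset ground M) &&
                                      (X \notin indep M)) C].

Section MatroidTheory.
Variables (T : finType) (M : matroid T).
Implicit Types I J B C X : {set T}.

Lemma indep_ground I : I \in indep M -> I \subset ground M.
Proof. by case: (matroidP M) => + _ _ _; apply. Qed.

Lemma indep0 : set0 \in indep M.
Proof. by case: (matroidP M). Qed.

Lemma indepS I J : J \in indep M -> I \subset J -> I \in indep M.
Proof. by case: (matroidP M) => _ _ + _; apply. Qed.

Lemma indep_aug I J : I \in indep M -> J \in indep M -> #|I| < #|J| ->
  exists2 x, x \in J :\: I & x |: I \in indep M.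
Proof. by case: (matroidP M) => _ _ _; apply. Qed.

Lemma dep_circuit X : X \subset ground M -> X \notin indep M ->
  exists2 C, C \in circuits M & C \subset X.
Proof.
move=> XE Xd.
have [|C minC CX] := @minset_exists T
  (fun X : {set T} => (X \subset ground M) && (X \notin indep M)) X.
  by rewrite XE Xd.
by exists C => //; rewrite inE.
Qed.

Lemma circuit_dep C : C \in circuits M -> C \notin indep M.
Proof. by rewrite inE => /minsetp/andP[]. Qed.

Lemma circuit_ground C : C \in circuits M -> C \subset ground M.
Proof. by rewrite inE => /minsetp/andP[]. Qed.

End MatroidTheory.

Section Uniform.
Variables (T : finType) (E : {set T}) (k : nat).

Definition uniform_indep := [set I : {set T} | (I \subset E) && (#|I| <= k)].

Lemma uniform_axioms : matroid_axioms E uniform_indep.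
Proof.
split=> [I||I J|I J].
- by rewrite inE => /andP[].
- by rewrite inE sub0set cards0.
- rewrite !inE => /andP[JE Jk] IJ.
  by rewrite (subset_trans IJ JE) (leq_trans (subset_leq_card IJ)).
- rewrite !inE => /andP[IE Ik] /andP[JE Jk] ltIJ.
  have /subsetPn[x xJ xI] : ~~ (J \subset I).
    by apply: contraL ltIJ => /subset_leq_card; rewrite -leqNgt.
  exists x; first by rewrite inE xI.
  rewrite inE subUset sub1set (subsetP JE) //= IE cardsU1 xI /=.
  exact: leq_trans ltIJ Jk.
Qed.

Definition uniform := Matroid uniform_axioms.

End Uniform.

Section Truncation.
Variables (T : finType) (N : matroid T) (k : nat).

Definition truncation_indep := [set I in indep N | #|I| <= k].

Lemma truncation_axioms : matroid_axioms (ground N) truncation_indep.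
Proof.
split=> [I||I J|I J].
- by rewrite inE => /andP[/indep_ground].
- by rewrite inE indep0 cards0.
- rewrite !inE => /andP[JN Jk] IJ.
  by rewrite (indepS JN IJ) (leq_trans (subset_leq_card IJ)).
- rewrite !inE => /andP[IN Ik] /andP[JN Jk] ltIJ.
  have [x xJI xI] := indep_aug IN JN ltIJ; exists x => //.
  move: xJI; rewrite !inE => /andP[xnI _].
  by rewrite xI cardsU1 xnI /= (leq_trans ltIJ).
Qed.

Definition truncation := Matroid truncation_axioms.

End Truncation.

Section Deletion.
Variables (T : finType) (M : matroid T) (D : {set T}).

Definition deletion_indep := [set I in indep M | I \subset ground M :\: D].

Lemma deletion_axioms : matroid_axioms (ground M :\: D) deletion_indep.
Proof.
split=> [I||I J|I J].
- by rewrite inE => /andP[].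
- by rewrite inE indep0 sub0set.
- rewrite !inE => /andP[JM JD] IJ.
  by rewrite (indepS JM IJ) (subset_trans IJ).
- rewrite !inE => /andP[IM ID] /andP[JM JD] ltIJ.
  have [x xJI xI] := indep_aug IM JM ltIJ; exists x => //.
  move: xJI; rewrite inE => /andP[_ xJ].
  by rewrite inE xI subUset sub1set (subsetP JD).
Qed.

Definition deletion := Matroid deletion_axioms.

End Deletion.

Section Contraction.
Variables (T : finType) (M : matroid T) (C : {set T}).

Definition basis_of_set (B : {set T}) : bool :=
  maxset (fun X : {set T} => (X \in indep M) && (X \subset C)) B.

Definition contraction_indep :=
  [set I : {set T} | (I \subset ground M :\: C) &&
                     [exists B, basis_of_set B && (I :|: B \in indep M)]].

Lemma basis_exchange (I B B' : {set T}) :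
  [disjoint I & C] -> basis_of_set B -> basis_of_set B' ->
  I :|: B \in indep M -> I :|: B' \in indep M.
Proof.
move=> dIC bB bB' IB.
have /andP[B'M B'C] := maxsetp bB'.
have /andP[BM BC] := maxsetp bB.
pose P (X : {set T}) := [&& X \in indep M, B' \subset X & X \subset I :|: B'].
have [|X /maxsetP[/and3P[XM B'X XI] maxX] _] := @maxset_exists T P B'.
  by rewrite /P B'M subxx subsetUr.
have key (Y : {set T}) : Y \in indep M -> #|Y| <= #|X| \/
    exists2 x, x \in Y :\: X & x |: X \in indep M.
  move=> YM; case: (leqP #|Y| #|X|) => [|lt]; first by left.
  by right; apply: indep_aug.
case: (key _ IB) => [le|[x]]; last first.
  rewrite !inE => /andP[xX /orP[xI|xB]] xM.
    have: x |: X = X.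
      apply: maxX; last exact: subsetUr.
      rewrite /P xM subsetU ?B'X ?orbT //= subUset XI andbT sub1set.
      by rewrite inE xI.
    by move=> e; move: xX; rewrite -e !inE eqxx.
  case/maxsetP: bB' => _ /(_ (x |: B')) e.
  have: x |: B' = B'.
    apply: e; last exact: subsetUr.
    rewrite (indepS xM (setUS _ B'X)) subUset sub1set (subsetP BC) //.
  by move=> e'; move: xX; rewrite (subsetP B'X) // -e' !inE eqxx.
suff <- : X = I :|: B' by [].
apply/eqP; rewrite eqEcard XI /=; apply: leq_trans le.
have dI (Y : {set T}) : Y \subset C -> #|I :|: Y| = #|I| + #|Y|.
  move=> YC; apply/eqP; rewrite (leq_card_setU I Y).2.
  by rewrite disjoint_sym (disjointWl YC) // disjoint_sym.
rewrite !dI // leq_add2l.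
case: (leqP #|B'| #|B|) => // lt.
have [x] := indep_aug BM B'M lt; rewrite !inE => /andP[xB xB'] xM.
case/maxsetP: bB => _ /(_ (x |: B)) e.
have: x |: B = B.
  apply: e; last exact: subsetUr.
  by rewrite xM subUset sub1set (subsetP B'C).
by move=> e'; move: xB; rewrite -e' !inE eqxx.
Qed.

Lemma contraction_axioms : matroid_axioms (ground M :\: C) contraction_indep.
Proof.
have dj (I : {set T}) : I \subset ground M :\: C -> [disjoint I & C].
  by rewrite subsetD => /andP[].
split=> [I||I J|I J].
- by rewrite inE => /andP[].
- rewrite inE sub0set /=.
  have [|B bB _] := @maxset_exists T
     (fun X : {set T} => (X \in indep M) && (X \subset C)) set0.
    by rewrite indep0 sub0set.
  apply/existsP; exists B; rewrite set0U /basis_of_set bB.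
  by case/andP: (maxsetp bB).
- rewrite !inE => /andP[JE /existsP[B /andP[bB JB]]] IJ.
  rewrite (subset_trans IJ JE); apply/existsP; exists B.
  by rewrite bB (indepS JB) // setSU.
- rewrite !inE => /andP[IE /existsP[B /andP[bB IB]]].
  move=> /andP[JE /existsP[B' /andP[bB' JB']]] lt.
  have JB := basis_exchange (dj _ JE) bB' bB JB'.
  have /andP[_ BC] := maxsetp bB.
  have dI (Y : {set T}) : Y \subset ground M :\: C -> #|Y :|: B| = #|Y| + #|B|.
    move=> /dj dY; apply/eqP; rewrite (leq_card_setU Y B).2.
    by rewrite disjoint_sym (disjointWl BC) // disjoint_sym.
  have [|x] := indep_aug IB JB; first by rewrite !dI // ltn_add2r.
  rewrite !inE negb_or -andbA => /and3P[xI xB].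
  rewrite (negPf xB) orbF => xJ xM; exists x; first by rewrite !inE xI.
  rewrite inE subUset sub1set (subsetP JE) // IE /=.
  by apply/existsP; exists B; rewrite bB -setUA.
Qed.

Definition contraction := Matroid contraction_axioms.

End Contraction.

Definition has_minor (T T' : finType) (M : matroid T) (N : matroid T') :
    Prop :=
  exists C D : {set T},
    [/\ C \subset ground M, D \subset ground M, [disjoint C & D]
      & isomorphic (deletion (contraction M C) D) N].

Definition laminar_family (T : finType) (A : {set {set T}}) : Prop :=
  forall X Y : {set T}, X \in A -> Y \in A -> X :&: Y != set0 ->
    X \subset Y \/ Y \subset X.

Section LaminarMatroid.
Variables (T : finType) (E : {set T}) (A : {set {set T}}) (c : {set T} -> nat).
Hypotheses (lamA : laminar_family A).

Definition laminar_indep :=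
  [set I : {set T} | (I \subset E) && [forall X in A, #|I :&: X| <= c X]].

Lemma laminar_axioms : matroid_axioms E laminar_indep.
Proof.
split=> [I||I J|I J].
- by rewrite inE => /andP[].
- rewrite inE sub0set /=; apply/forall_inP => X _.
  by rewrite set0I cards0.
- rewrite !inE => /andP[JE /forall_inP Jc] IJ.
  rewrite (subset_trans IJ JE); apply/forall_inP => X XA.
  by apply: leq_trans (Jc X XA); apply/subset_leq_card/setSI.
rewrite !inE => /andP[IE /forall_inP Ic] /andP[JE /forall_inP Jc] lt.
case: (boolP [exists x in J :\: I, x |: I \in laminar_indep]).
  by move=> /exists_inP[x xJI xI]; exists x.
rewrite negb_exists_in => /forall_inP noaug; exfalso.
pose tight (X : {set T}) := (X \in A) && (#|I :&: X| == c X).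
pose Q := [set X | maxset tight X].
have QA (X : {set T}) : X \in Q -> X \in A.
  by rewrite inE => /maxsetp/andP[].
have Qt (X : {set T}) : X \in Q -> #|I :&: X| = c X.
  by rewrite inE => /maxsetp/andP[_ /eqP].
have trivQ : trivIset Q.
  apply/trivIsetP => X Y XQ YQ; apply: contraR.
  rewrite -setI_eq0 => XY.
  have /maxsetP[tX maxX] : maxset tight X by rewrite inE in XQ.
  have /maxsetP[tY maxY] : maxset tight Y by rewrite inE in YQ.
  case: (lamA (QA _ XQ) (QA _ YQ) XY) => s.
    by rewrite (maxX _ tY s).
  by rewrite (maxY _ tX s).
have covJ x : x \in J :\: I -> x \in cover Q.
  move=> xJI; have := noaug x xJI.
  move: xJI; rewrite !inE => /andP[xI xJ].
  rewrite subUset sub1set (subsetP JE) // IE /= negb_forall_in.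
  move=> /exists_inP[X XA]; rewrite -ltnNge => cX.
  have xX : x \in X.
    apply: contraLR cX => xX; rewrite -leqNgt; apply: leq_trans (Ic X XA).
    apply/subset_leq_card/subsetP => y; rewrite !inE.
    by case: eqP => [->|_]; rewrite ?(negPf xX) ?andbF.
  have tX : tight X.
    rewrite /tight XA eqn_leq Ic //= -ltnS; apply: leq_trans cX _.
    rewrite setIUl; apply: leq_trans (leq_card_setU _ _).1 _.
    by rewrite -add1n leq_add2r -(cards1 x) subset_leq_card ?subsetIl.
  have [Y mY XY] := maxset_exists tX.
  by apply/bigcupP; exists Y; [rewrite inE | apply: (subsetP XY)].
have cardI (K X : {set T}) : #|K :&: X| = \sum_(x in X) (x \in K : nat).
  rewrite -sum1_card big_mkcond [RHS]big_mkcond /=; apply: eq_bigr => x _.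
  by rewrite inE; case: (x \in K); case: (x \in X).
have cardQ (K : {set T}) : #|K :&: cover Q| = \sum_(X in Q) #|K :&: X|.
  by rewrite cardI (big_trivIset _ trivQ) /=; apply: eq_bigr => X _; rewrite cardI.
have le1 : #|J :&: cover Q| <= #|I :&: cover Q|.
  rewrite !cardQ; apply: leq_sum => X XQ.
  by rewrite Qt // Jc // QA.
have le2 : #|J :\: cover Q| <= #|I :\: cover Q|.
  apply/subset_leq_card/subsetP => x; rewrite !inE => /andP[xQ xJ].
  rewrite xQ; apply: contraR xQ => xI.
  by apply: covJ; rewrite inE xI.
move: lt; rewrite -(cardsID (cover Q) I) -(cardsID (cover Q) J) ltnNge.
by rewrite leq_add.
Qed.

Definition laminar_matroid := Matroid laminar_axioms.

End LaminarMatroid.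

(* The values of c outside A are irrelevant. *)
Definition laminar (T : finType) (M : matroid T) : Prop :=
  exists (T' : finType) (E : {set T'}) (A : {set {set T'}})
         (c : {set T'} -> nat) (lamA : laminar_family A),
    A \subset powerset E /\ isomorphic M (laminar_matroid E c lamA).

Lemma subset_setU1 (T : finType) (p : T) (C X : {set T}) :
  p \notin C -> C \subset p |: X -> C \subset X.
Proof.
move=> pC /subsetP CX; apply/subsetP => x xC; have := CX x xC.
by rewrite !inE; case: eqP => // e; rewrite -e xC in pC.
Qed.

Lemma parallel_arith (a b i a' b' j : nat) (pI pJ : bool) :
  a + b = i + pI -> a' + b' = j + pJ -> i < j ->
  a' <= ~~ pI + a -> b' <= b -> ~~ pI + a < ~~ pJ + a' /\ b < ~~ pJ + b'.
Proof. by case: pI; case: pJ => /=; lia. Qed.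

Section ParallelAugmentation.
Variables (T : finType) (p : T).
Implicit Types (N : matroid T) (I J : {set T}).

Definition parallel_cond N1 N2 I :=
  [&& I \subset ground N1 :|: ground N2,
      I :&: ground N1 \in indep N1, I :&: ground N2 \in indep N2 &
      (p |: (I :&: ground N1) \in indep N1) ||
      (p |: (I :&: ground N2) \in indep N2)].

Lemma parallel_condC N1 N2 I : parallel_cond N1 N2 I = parallel_cond N2 N1 I.
Proof. by rewrite /parallel_cond setUC orbC; do 3!bool_congr. Qed.

Lemma parallel_add N1 N2 I x : ground N1 :&: ground N2 = [set p] ->
  parallel_cond N1 N2 I -> x != p ->
  x |: (I :&: ground N1) \in indep N1 ->
  (p |: (x |: (I :&: ground N1)) \in indep N1) ||
  (p |: (I :&: ground N2) \in indep N2) ->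
  parallel_cond N1 N2 (x |: I).
Proof.
move=> E12 /and4P[IE I1 I2 _] xp xI1 or.
have xE1 : x \in ground N1.
  by rewrite (subsetP (indep_ground xI1)) // !inE eqxx.
have xE2 : x \notin ground N2.
  by apply: contra xp => xE2; rewrite -in_set1 -E12 inE xE1.
rewrite /parallel_cond.
have -> : (x |: I) :&: ground N1 = x |: (I :&: ground N1).
  by apply/setP => y; rewrite !inE; case: eqP => // ->; rewrite xE1.
have -> : (x |: I) :&: ground N2 = I :&: ground N2.
  by apply/setP => y; rewrite !inE; case: eqP => // ->; rewrite (negPf xE2) !andbF.
by rewrite xI1 I2 or subUset sub1set inE xE1 IE.
Qed.

Lemma parallel_card N1 N2 I : ground N1 :&: ground N2 = [set p] ->
  I \subset ground N1 :|: ground N2 ->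
  #|I :&: ground N1| + #|I :&: ground N2| = #|I| + (p \in I).
Proof.
move=> E12 IE; rewrite -cardsUI -setIUr (setIidPl IE) -setIIr E12.
congr (_ + _); case: (boolP (p \in I)) => pI.
  by rewrite (setIidPr _) ?cards1 ?sub1set.
by apply/eqP; rewrite cards_eq0 setI_eq0 disjoint_sym disjoints1.
Qed.

Lemma setD_ground N I J x : x \in (J :&: ground N) :\: (I :&: ground N) ->
  x \in J :\: I.
Proof.
by rewrite !inE => /andP[h /andP[xJ xN]]; move: h; rewrite xJ xN !andbT.
Qed.

Lemma parallel_aug N1 N2 I J : ground N1 :&: ground N2 = [set p] ->
  parallel_cond N1 N2 I -> parallel_cond N1 N2 J -> #|I| < #|J| ->
  exists2 x, x \in J :\: I & parallel_cond N1 N2 (x |: I).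
Proof.
move=> E12 PI PJ lt.
wlog pI1 : N1 N2 E12 PI PJ / p |: (I :&: ground N1) \in indep N1.
  move=> wl; case/and4P: (PI) => _ _ _ /orP[h|h]; first exact: wl.
  have [|||x xJI xI] := wl N2 N1 _ _ _ h.
  - by rewrite setIC.
  - by rewrite parallel_condC.
  - by rewrite parallel_condC.
  - by exists x; rewrite // parallel_condC.
have E21 : ground N2 :&: ground N1 = [set p] by rewrite setIC.
have PI' : parallel_cond N2 N1 I by rewrite parallel_condC.
case/and4P: (PI) => IE I1 I2 _.
case/and4P: (PJ) => JE J1 J2 J12.
have cI := parallel_card E12 IE.
have cJ := parallel_card E12 JE.
have aug2 (K : {set T}) : K \in indep N2 -> K \subset p |: (J :&: ground N2) ->
    p \notin K \/ (p \in I) \/ p |: (I :&: ground N2) \notin indep N2 ->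
    #|I :&: ground N2| < #|K| ->
    exists2 x, x \in J :\: I & parallel_cond N1 N2 (x |: I).
  move=> KN KJ pK ltK.
  have [x xKI xN] := indep_aug I2 KN ltK.
  have xp : x != p.
    apply/eqP => e; move: xKI xN; rewrite e !inE => /andP[pI pK'] pN.
    case: pK => [/negP//|[pI'|/negP//]].
    case/negP: pI; rewrite pI' /=.
    by have := set11 p; rewrite -E12 inE => /andP[].
  exists x.
    apply: (@setD_ground N2); move: xKI; rewrite !in_setD => /andP[-> xK] /=.
    by have := subsetP KJ x xK; rewrite !inE (negPf xp).
  by rewrite parallel_condC; apply: parallel_add => //; rewrite pI1 orbT.
have aug1 (K : {set T}) : K \in indep N1 -> K \subset p |: (J :&: ground N1) ->
    #|p |: (I :&: ground N1)| < #|K| ->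
    exists2 x, x \in J :\: I & parallel_cond N1 N2 (x |: I).
  move=> KN KJ ltK.
  have [x] := indep_aug pI1 KN ltK; rewrite in_setD => /andP[xI xK] xN.
  have xp : x != p by apply: contra xI => /eqP->; rewrite !inE eqxx.
  exists x.
    apply: (@setD_ground N1); rewrite in_setD.
    move: xI; rewrite in_setU1 negb_or => /andP[_ ->] /=.
    by have := subsetP KJ x xK; rewrite !inE (negPf xp).
  apply: parallel_add => //; first by apply: indepS xN _; rewrite setUCA subsetUr.
  by rewrite setUCA xN.
have pE1 : p \in ground N1.
  by have := set11 p; rewrite -E12 inE => /andP[].
have pE2 : p \in ground N2.
  by have := set11 p; rewrite -E12 inE => /andP[].
have card1 : #|p |: (I :&: ground N1)| = (p \notin I) + #|I :&: ground N1|.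
  by rewrite cardsU1 inE pE1 andbT.
have cardJ1 : #|p |: (J :&: ground N1)| = (p \notin J) + #|J :&: ground N1|.
  by rewrite cardsU1 inE pE1 andbT.
have cardJ2 : #|p |: (J :&: ground N2)| = (p \notin J) + #|J :&: ground N2|.
  by rewrite cardsU1 inE pE2 andbT.
case: (ltnP #|p |: (I :&: ground N1)| #|J :&: ground N1|) => [|le1].
  by apply: aug1 => //; apply: subsetUr.
case: (boolP ((p \in I) || (p |: (I :&: ground N2) \notin indep N2))) => [h|].
  have {}h : (p \in I) \/ p |: (I :&: ground N2) \notin indep N2.
    by apply/orP.
  case: (ltnP #|I :&: ground N2| #|J :&: ground N2|) => [|le2].
    by apply: aug2 => //; [apply: subsetUr | right].
  have [lt1 lt2] := parallel_arith cI cJ lt (leq_trans le1 (eq_leq card1)) le2.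
  case/orP: J12 => [pJ1|pJ2].
    by apply: (aug1 _ pJ1); rewrite // card1 cardJ1.
  by apply: (aug2 _ pJ2); rewrite // ?cardJ2 //; right.
rewrite negb_or negbK => /andP[pI pI2].
case: (boolP (p \in J)) => pJ.
  exists p; first by rewrite !inE pI.
  have e N : p \in ground N -> (p |: I) :&: ground N = p |: (I :&: ground N).
    by move=> pN; apply/setP => y; rewrite !inE; case: eqP => // ->; rewrite pN.
  rewrite /parallel_cond !e // !setUA setUid pI1 pI2 /= andbT.
  by rewrite subUset sub1set inE pE1.
have ltor : (#|I :&: ground N1| < #|J :&: ground N1|) \/
            (#|I :&: ground N2| < #|J :&: ground N2|).
  move: cI cJ lt; rewrite (negPf pJ) (negPf pI) !addn0 => <- <-.
  move=> lt'; case: (ltnP #|I :&: ground N1|) => [_|le1']; first by left.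
  by right; move: lt'; rewrite !ltnNge; apply: contra => le2'; rewrite leq_add.
case: ltor => ltk.
  have [x xJI xN] := indep_aug I1 J1 ltk.
  exists x; first exact: setD_ground xJI.
  apply: parallel_add => //; last by rewrite pI2 orbT.
  by apply: contraNneq pJ => <-; case/setDP: xJI => /setIP[].
apply: (aug2 _ J2) => //; first exact: subsetUr.
by left; rewrite inE (negPf pJ).
Qed.

End ParallelAugmentation.

Section ParallelConnection.
Variables (T : finType) (M1 M2 : matroid T) (p : T).

(* When p is neither a loop of M1 nor a loop of M2, this is exactly the set  *)
(* of circuits of the parallel connection.                                   *)
Definition parallel_circuits : {set {set T}} :=
  circuits M1 :|: circuits M2 :|:
  [set (C1 :\ p) :|: (C2 :\ p) | C1 in [set C in circuits M1 | p \in C],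
                                 C2 in [set C in circuits M2 | p \in C]].

Definition parallel_indep :=
  [set I : {set T} | (I \subset ground M1 :|: ground M2) &&
                     [forall C in parallel_circuits, ~~ (C \subset I)]].

Hypotheses (E12 : ground M1 :&: ground M2 = [set p])
           (p1 : [set p] \in indep M1) (p2 : [set p] \in indep M2).

Let pE1 : p \in ground M1.
Proof. by rewrite -sub1set indep_ground. Qed.

Let pE2 : p \in ground M2.
Proof. by rewrite -sub1set indep_ground. Qed.

Lemma parallel_indepE (I : {set T}) : I \subset ground M1 :|: ground M2 ->
  (I \in parallel_indep) =
  [&& I :&: ground M1 \in indep M1, I :&: ground M2 \in indep M2 &
      (p |: (I :&: ground M1) \in indep M1) ||
      (p |: (I :&: ground M2) \in indep M2)].
Proof.
move=> IE; rewrite inE IE andTb.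
apply/forall_inP/and3P => [noC|[I1 I2 I12] C].
  have i1 : I :&: ground M1 \in indep M1.
    apply/negPn/negP => /(dep_circuit (subsetIr _ _))[C C1].
    rewrite subsetI => /andP[CI _].
    suff /noC : C \in parallel_circuits by rewrite CI.
    by rewrite !in_setU C1.
  have i2 : I :&: ground M2 \in indep M2.
    apply/negPn/negP => /(dep_circuit (subsetIr _ _))[C C2].
    rewrite subsetI => /andP[CI _].
    suff /noC : C \in parallel_circuits by rewrite CI.
    by rewrite !in_setU C2 orbT.
  split=> //; apply/negPn/negP; rewrite negb_or => /andP[d1 d2].
  have [|C1 c1 s1] := dep_circuit _ d1.
    by rewrite subUset sub1set pE1 subsetIr.
  have [|C2 c2 s2] := dep_circuit _ d2.
    by rewrite subUset sub1set pE2 subsetIr.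
  have pC1 : p \in C1.
    apply: contraLR i1 => pC1; apply: contra (circuit_dep c1) => i.
    exact: indepS i (subset_setU1 pC1 s1).
  have pC2 : p \in C2.
    apply: contraLR i2 => pC2; apply: contra (circuit_dep c2) => i.
    exact: indepS i (subset_setU1 pC2 s2).
  have: (C1 :\ p) :|: (C2 :\ p) \in parallel_circuits.
    rewrite in_setU; apply/orP; right; apply/imset2P.
    by exists C1 C2 => //; rewrite in_set ?c1 ?c2 ?pC1 ?pC2.
  move/noC/negP; apply.
  apply/subsetP => x; rewrite !inE => /orP[]/andP[np xC].
    by have := subsetP s1 x xC; rewrite !inE (negPf np) => /andP[].
  by have := subsetP s2 x xC; rewrite !inE (negPf np) => /andP[].
rewrite !in_setU -orbA => /or3P[c1|c2|/imset2P[C1 C2]].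
- apply: contra (circuit_dep c1) => CI; apply: indepS I1 _.
  by rewrite subsetI CI circuit_ground.
- apply: contra (circuit_dep c2) => CI; apply: indepS I2 _.
  by rewrite subsetI CI circuit_ground.
rewrite in_set => /andP[c1 pC1]; rewrite in_set => /andP[c2 pC2] ->.
have sub (D E : {set T}) : D \subset E -> D :\ p \subset I ->
    D \subset p |: (I :&: E).
  move=> /subsetP DE /subsetP DI; apply/subsetP => x xD.
  have := DI x; rewrite !inE xD (DE x xD) andbT andbT.
  by case: eqP => //= _ /(_ isT).
apply/negP; rewrite subUset => /andP[s1 s2].
case/orP: I12 => [/indepS/(_ (sub _ _ (circuit_ground c1) s1))|
                  /indepS/(_ (sub _ _ (circuit_ground c2) s2))].
  exact/negP/circuit_dep.
exact/negP/circuit_dep.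
Qed.

Lemma parallel_indep_cond (I : {set T}) :
  (I \in parallel_indep) = parallel_cond p M1 M2 I.
Proof.
rewrite /parallel_cond.
case: (boolP (I \subset _)) => [IE|nIE]; first by rewrite parallel_indepE.
by rewrite inE (negPf nIE).
Qed.

Lemma parallel_axioms : matroid_axioms (ground M1 :|: ground M2) parallel_indep.
Proof.
split=> [I||I J|I J].
- by rewrite inE => /andP[].
- by rewrite parallel_indep_cond /parallel_cond sub0set !set0I !indep0 setU0 p1.
- rewrite !inE => /andP[JE /forall_inP JC] IJ.
  rewrite (subset_trans IJ JE); apply/forall_inP => C /JC.
  by apply: contra => CI; apply: subset_trans CI IJ.
- rewrite !parallel_indep_cond => PI PJ lt.
  have [x xJI xI] := parallel_aug E12 PI PJ lt.
  by exists x; rewrite // parallel_indep_cond.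
Qed.

Definition parallel_connection := Matroid parallel_axioms.

End ParallelConnection.

Section Y.
Variable r : nat.

(* None is the basepoint. *)
Definition Y_carrier : finType := option ('I_r.-1 + 'I_r.-1)%type.

Definition Y_ground1 : {set Y_carrier} :=
  None |: [set Some (inl i) | i : 'I_r.-1].
Definition Y_ground2 : {set Y_carrier} :=
  None |: [set Some (inr i) | i : 'I_r.-1].

Definition Y_circuit1 : matroid Y_carrier := uniform Y_ground1 r.-1.
Definition Y_circuit2 : matroid Y_carrier := uniform Y_ground2 r.-1.

Lemma Y_groundI : ground Y_circuit1 :&: ground Y_circuit2 = [set None].
Proof.
apply/setP => x; rewrite !inE /=; case: x => [y|] //=.
apply/negP => /andP[/imsetP[i _ ->] /imsetP[j _]].
by [].
Qed.

Hypothesis r3 : 3 <= r.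

Lemma Y_nonloop1 : [set None] \in indep Y_circuit1.
Proof. by rewrite inE sub1set !inE eqxx cards1; case: r r3 => [|[|]]. Qed.

Lemma Y_nonloop2 : [set None] \in indep Y_circuit2.
Proof. by rewrite inE sub1set !inE eqxx cards1; case: r r3 => [|[|]]. Qed.

Definition Y : matroid Y_carrier :=
  truncation (parallel_connection Y_groundI Y_nonloop1 Y_nonloop2) r.

End Y.

(* Main.v *)
(* Say that M has nested circuits when, of any two meeting circuits, one lies *)
(* in the closure of the other. If so, the closures of circuits (without the  *)
(* loops) form a laminar family, and their ranks as capacities give back M.   *)
(* If not, contract elements as long as two meeting circuits C1, C2 that are  *)
(* not nested survive. At the end C1 and C2 share a single element, both are  *)
(* hyperplanes of M restricted to C1 :|: C2, and all other circuits in        *)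
(* C1 :|: C2 are spanning: this restriction is Y r with r = #|C1|.            *)
(* Conversely, in a laminar matroid two sets of the family witness that C1    *)
(* and C2 are dependent over the contracted set K; both contain the common    *)
(* element, so the larger one contains C1 :|: C2, and then its capacity       *)
(* forbids every other r-subset of C1 :|: C2 as well.                         *)
Require Import Defs.
From mathcomp Require Import all_boot zify.

Set Implicit Arguments.
Unset Strict Implicit.
Unset Printing Implicit Defensive.

(** Laminarity and the excluded minors meet in [nested_circuits]. If it holds, [nested_cl] extends
    comparability from meeting circuits to circuits whose closures share a nonloop. Closures of
    circuits without the loops are therefore laminar ([flat_family_laminar]), and
    [flat_family_indep] recovers [M] because a circuit has one element more than its rank. A failure
    is a [crossing]. [crossing_minor] contracts nonloops until no contraction has a crossing. Every
    contraction of a nonloop of the resulting matroid then makes the contracted pair nested or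
    destroys it, which forces a single common element ([crossing_uniq]), equal sizes
    ([crossing_card]) and no further small circuits ([crossing_circuit]). What is left is a
    [Y_config]. By [Y_indep], this describes [Y r] through two circuits of size [r] with one common
    point, and [Y_config_minor] and [minor_Y_config] translate it to and from minors.
    [laminar_Y_config] shows that a laminar matroid has none. *)

(** * Rank, closure and fundamental circuits *)

Section RankClosure.
Variables (T : finType) (M : matroid T).
Implicit Types (I J X Y C D : {set T}) (x y : T).

Definition rk X := \max_(I in indep M | I \subset X) #|I|.

(** Elements outside [ground M] never change the rank, so they lie in every closure and behave like
    loops. *)
Definition cl X := [set x | rk (x |: X) == rk X].

Lemma indep_leq_rk I X : I \in indep M -> I \subset X -> #|I| <= rk X.
Proof.
by move=> iI IX; apply: (bigmax_sup I); rewrite ?iI.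
Qed.

Lemma rk_extend I X : I \in indep M -> I \subset X ->
  exists J, [/\ J \in indep M, I \subset J, J \subset X & #|J| = rk X].
Proof.
move=> iI IX.
pose P J := (J \in indep M) && (J \subset X).
have [|J maxJ IJ] := @maxset_exists T P I; first by rewrite /P iI.
have /andP[iJ JX] := maxsetp maxJ.
exists J; split=> //; apply/eqP; rewrite eqn_leq indep_leq_rk //=.
apply/bigmax_leqP => L /andP[iL LX]; rewrite leqNgt; apply/negP => lt.
have [x] := indep_aug iJ iL lt; rewrite inE => /andP[xJ xL] xi.
suff e : x |: J = J by move: xJ; rewrite -e setU11.
have /maxsetP[_ J_max] := maxJ; apply: J_max; last exact: subsetUr.
by rewrite /P xi subUset sub1set (subsetP LX).
Qed.

Lemma rk_card X : rk X <= #|X|.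
Proof. by apply/bigmax_leqP => I /andP[_ /subset_leq_card]. Qed.

Lemma rkS X Y : X \subset Y -> rk X <= rk Y.
Proof.
move=> XY; apply/bigmax_leqP => I /andP[iI IX].
exact: indep_leq_rk iI (subset_trans IX XY).
Qed.

Lemma indepE I : (I \in indep M) = (rk I == #|I|).
Proof.
apply/idP/eqP => [iI|e].
  by apply/eqP; rewrite eqn_leq rk_card indep_leq_rk.
have [J [iJ _ JI cJ]] := rk_extend (indep0 M) (sub0set I).
suff -> : I = J by [].
by apply/eqP; rewrite eq_sym eqEcard JI cJ e leqnn.
Qed.

Lemma rk_indep I : I \in indep M -> rk I = #|I|.
Proof. by rewrite indepE => /eqP. Qed.

Lemma rk0 : rk set0 = 0.
Proof. by rewrite rk_indep ?cards0 ?indep0. Qed.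

(** A basis [I] of the intersection extends to a basis [J] of the union. The traces of [J] on [X]
    and [Y] are independent, cover [J], and both contain [I]. *)
Lemma rk_submod X Y : rk (X :|: Y) + rk (X :&: Y) <= rk X + rk Y.
Proof.
have [I [iI _ IXY <-]] := rk_extend (indep0 M) (sub0set (X :&: Y)).
have [|J [iJ IJ JXY <-]] := rk_extend iI (X := X :|: Y).
  exact: subset_trans IXY (subset_trans (subsetIl _ _) (subsetUl _ _)).
have rJ Z : #|J :&: Z| <= rk Z.
  by apply: indep_leq_rk (subsetIr _ _); apply: indepS iJ (subsetIl _ _).
apply: leq_trans (leq_add (rJ X) (rJ Y)).
rewrite -[X in _ <= X]cardsUI -setIUr (setIidPl JXY) leq_add2l -setIIr.
by rewrite subset_leq_card // subsetI IJ.
Qed.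

Lemma rkU1 x X : rk (x |: X) <= (rk X).+1.
Proof.
apply: leq_trans (leq_trans (leq_addr _ _) (rk_submod [set x] X)) _.
by rewrite -add1n leq_add2r (leq_trans (rk_card _)) ?cards1.
Qed.

(** If the union had larger rank, augmenting a basis of [X] would find one single element of
    [X :|: Y] that already raises the rank of [X]. *)
Lemma rkU_cl X Y : Y \subset cl X -> rk (X :|: Y) = rk X.
Proof.
move=> /subsetP Ycl; apply/eqP; rewrite eqn_leq (rkS (subsetUl _ _)) andbT.
have [I [iI _ IX cI]] := rk_extend (indep0 M) (sub0set X).
have [J [iJ _ JXY <-]] := rk_extend (indep0 M) (sub0set (X :|: Y)).
rewrite leqNgt -cI; apply/negP => lt.
have [x] := indep_aug iI iJ lt; rewrite inE => /andP[xI xJ] xi.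
have rkx : rk (x |: X) = rk X.
  case/setUP: (subsetP JXY x xJ) => [xX|/Ycl].
    by rewrite (setUidPr _) ?sub1set.
  by rewrite inE => /eqP.
by have := indep_leq_rk xi (setUS [set x] IX); rewrite rkx -cI cardsU1 xI ltnn.
Qed.

Lemma sub_cl X Y : (Y \subset cl X) = (rk (X :|: Y) <= rk X).
Proof.
apply/idP/idP => [/rkU_cl->//|le]; apply/subsetP => y yY.
rewrite inE eqn_leq (rkS (subsetUr _ _)) andbT; apply: leq_trans le.
by rewrite rkS // setUC setUS ?sub1set.
Qed.

Lemma mem_cl X x : (x \in cl X) = (rk (x |: X) <= rk X).
Proof. by rewrite -sub1set sub_cl setUC. Qed.

Lemma subset_cl X : X \subset cl X.
Proof. by rewrite sub_cl setUid. Qed.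

Lemma cl_sub X Y : X \subset cl Y -> cl X \subset cl Y.
Proof.
move=> XY; rewrite sub_cl.
apply: leq_trans (rkS (_ : _ \subset (Y :|: X) :|: cl X)) _.
  by rewrite -setUA setUS // subsetUr.
rewrite -(rkU_cl XY) -(leq_add2r (rk X)).
have := rk_submod (Y :|: X) (X :|: cl X).
rewrite (rkU_cl (subxx (cl X))) => le; apply: leq_trans le.
rewrite leq_add // rkS ?subsetI ?subsetUr ?subsetUl //.
by rewrite setUS // subsetUr.
Qed.

Lemma clS X Y : X \subset Y -> cl X \subset cl Y.
Proof. by move=> XY; apply: cl_sub (subset_trans XY (subset_cl Y)). Qed.

Lemma subset_cl_trans X Y D : X \subset cl Y -> Y \subset cl D ->
  X \subset cl D.
Proof. by move=> XY /cl_sub; apply: subset_trans. Qed.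

Lemma nonloop_indep x : x \notin cl set0 -> [set x] \in indep M.
Proof.
rewrite mem_cl rk0 setU0 -ltnNge => gt0.
by rewrite indepE cards1 eqn_leq gt0 andbT -(cards1 x) rk_card.
Qed.

Lemma nonloop_ground x : x \notin cl set0 -> x \in ground M.
Proof. by move/nonloop_indep/indep_ground; rewrite sub1set. Qed.

Lemma circuitP C : reflect
  [/\ C \subset ground M, C \notin indep M
    & forall x, x \in C -> C :\ x \in indep M] (C \in circuits M).
Proof.
rewrite inE; apply: (iffP idP) => [/minsetP[/andP[CE Cd] Cmin]|[CE Cd Ci]].
  split=> // x xC; apply: contraT => d.
  have := Cmin (C :\ x); rewrite d (subset_trans (subsetDl _ _) CE) subsetDl.
  by move=> /(_ isT isT) /setP/(_ x); rewrite !inE eqxx xC.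
apply/minsetP; split=> [|D /andP[DE Dd] DC]; first by rewrite CE.
apply/eqP; rewrite eqEsubset DC; apply/subsetP => x xC.
apply: contraR Dd => xD; apply: indepS (Ci x xC) _.
by rewrite subsetD1 DC.
Qed.

Lemma circuitD1 C x : C \in circuits M -> x \in C -> C :\ x \in indep M.
Proof. by case/circuitP => _ _; apply. Qed.

Lemma circuit_sub C D : C \in circuits M -> D \in circuits M -> D \subset C ->
  D = C.
Proof.
rewrite !inE => /minsetP[_ Cmin] /minsetp; exact: Cmin.
Qed.

Lemma circuit_neq0 C : C \in circuits M -> exists x, x \in C.
Proof.
move=> cC; apply/set0Pn; apply: contraL (circuit_dep cC) => /eqP->.
by rewrite indep0.
Qed.

Lemma circuit_rkD1 C x : C \in circuits M -> x \in C -> rk (C :\ x) = rk C.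
Proof.
move=> cC xC; apply/eqP; rewrite eqn_leq rkS ?subsetDl //=.
rewrite (rk_indep (circuitD1 cC xC)) -ltnS.
have <- : #|C| = #|C :\ x|.+1 by rewrite (cardsD1 x) xC.
by rewrite ltn_neqAle rk_card andbT -indepE (circuit_dep cC).
Qed.

Lemma rk_circuit C : C \in circuits M -> (rk C).+1 = #|C|.
Proof.
move=> cC; have [x xC] := circuit_neq0 cC.
by rewrite -(circuit_rkD1 cC xC) (rk_indep (circuitD1 cC xC)) (cardsD1 x C) xC.
Qed.

Lemma circuit_cl C x : C \in circuits M -> x \in C -> x \in cl (C :\ x).
Proof. by move=> cC xC; rewrite mem_cl setD1K // circuit_rkD1. Qed.

Lemma circuit_clD1 C x : C \in circuits M -> x \in C ->
  cl C \subset cl (C :\ x).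
Proof.
move=> cC xC; rewrite cl_sub // -{1}(setD1K xC) subUset sub1set circuit_cl //.
exact: subset_cl.
Qed.

Lemma circuit_nonloop C x : C \in circuits M -> x \in C -> x \notin cl set0 ->
  exists2 y, y \in C & y != x.
Proof.
move=> cC xC; case: (set_0Vmem (C :\ x)) => [e|[y]].
  by rewrite -{1}e circuit_cl.
by rewrite !inE => /andP[yx yC]; exists y.
Qed.

(** For [y] in [C] but not in [D], a basis [J] of [x |: I] extending [C :\ y] misses [y] and has at
    least [#|I|] elements. So it is all of [x |: I] except [y], and contains [D]. *)
Lemma fundamental_circuit_uniq I x C D : I \in indep M ->
  C \in circuits M -> D \in circuits M ->
  C \subset x |: I -> D \subset x |: I -> C = D.
Proof.
move=> iI cC cD CI DI; apply/esym/eqP.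
apply: contraT => neq.
have /subsetPn[y yC yD] : ~~ (C \subset D).
  by apply: contra neq => /(circuit_sub cD cC)->.
have [|J [iJ CJ JI cJ]] := rk_extend (circuitD1 cC yC) (X := x |: I).
  exact: subset_trans (subsetDl _ _) CI.
have yJ : y \notin J.
  apply: contra (circuit_dep cC) => yJ; apply: indepS iJ _.
  by rewrite -(setD1K yC) subUset sub1set yJ.
have geI : #|I| <= #|J| by rewrite cJ indep_leq_rk // subsetUr.
have JE : J = (x |: I) :\ y.
  apply/eqP; rewrite eqEcard subsetD1 JI yJ /=.
  apply: leq_trans geI; rewrite -ltnS.
  have <- : #|x |: I| = #|(x |: I) :\ y|.+1.
    by rewrite (cardsD1 y) (subsetP CI).
  by rewrite cardsU1; case: (x \notin I).
case/negP: (circuit_dep cD); apply: indepS iJ _.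
by rewrite JE subsetD1 DI.
Qed.

Lemma cl_circuit X x : x \in ground M -> x \notin X -> x \in cl X ->
  exists C, [/\ C \in circuits M, x \in C & C \subset x |: X].
Proof.
move=> xE xX; rewrite mem_cl => le.
have [I [iI _ IX cI]] := rk_extend (indep0 M) (sub0set X).
have [||C cC CI] := @dep_circuit _ M (x |: I).
- by rewrite subUset sub1set xE indep_ground.
- apply/negP => xi; move: le; rewrite leqNgt -cI; case/negP.
  have xI : x \notin I by apply: contra xX; apply: (subsetP IX).
  have <- : #|x |: I| = #|I|.+1 by rewrite cardsU1 xI.
  exact: indep_leq_rk xi (setUS _ IX).
exists C; split=> //; last exact: subset_trans CI (setUS _ IX).
apply: contraLR iI => xC; apply: contra (circuit_dep cC) => iI.
exact: indepS iI (subset_setU1 xC CI).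
Qed.

(** If some [y] in [C] were missed by both, then [D] and [D'] would be two circuits in
    [x |: C :\ y], where [C :\ y] is independent. *)
Lemma circuit_cover C D D' x :
  C \in circuits M -> D \in circuits M -> D' \in circuits M -> D != D' ->
  D \subset x |: C -> D' \subset x |: C -> x \notin C -> C \subset D :|: D'.
Proof.
move=> cC cD cD' neq DC D'C xC; apply/subsetP => y yC; apply: contraT.
rewrite inE negb_or => /andP[yD yD'].
have sub (L : {set T}) : L \subset x |: C -> y \notin L ->
    L \subset x |: C :\ y.
  move=> /subsetP LC yL; apply/subsetP => z zL; have := LC z zL.
  by rewrite !inE; case: (eqVneq z y) => // e; rewrite -e zL in yL.
case/eqP: neq; apply: (fundamental_circuit_uniq (circuitD1 cC yC) cD cD');
  exact: sub.
Qed.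

(** [C :\ y] still spans [C], so [x] has a circuit inside [x |: C :\ y]. *)
Lemma cl_circuit_avoid C x y : C \in circuits M -> y \in C -> x \notin C ->
  x \in cl C -> x \in ground M ->
  exists D, [/\ D \in circuits M, x \in D, y \notin D & D \subset x |: C].
Proof.
move=> cC yC xC xcl xE.
have [||D [cD xD DC]] := @cl_circuit (C :\ y) x xE.
- by rewrite inE negb_and xC orbT.
- exact: subsetP (circuit_clD1 cC yC) x xcl.
exists D; split=> //; last exact: subset_trans DC (setUS _ (subsetDl _ _)).
apply/negP => /(subsetP DC); rewrite !inE eqxx orbF => /eqP e.
by rewrite -e yC in xC.
Qed.

End RankClosure.

(** * From nested circuits to a laminar presentation *)

Definition nested_circuits (T : finType) (M : matroid T) : Prop :=
  forall C D : {set T}, C \in circuits M -> D \in circuits M ->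
    C :&: D != set0 -> C \subset cl M D \/ D \subset cl M C.

Section NestedClosures.
Variables (T : finType) (M : matroid T).
Hypothesis nestM : nested_circuits M.
Implicit Types (I C D : {set T}) (x : T).

Lemma nested_circuits_mem C D x : C \in circuits M -> D \in circuits M ->
  x \in C -> x \in D -> C \subset cl M D \/ D \subset cl M C.
Proof.
move=> cC cD xC xD; apply: nestM => //.
by apply/set0Pn; exists x; rewrite inE xC.
Qed.

(** When [x] is not in [D], take two distinct circuits through [x] inside [x |: D]. Each of them
    meets [C] in [x], so either it yields [C \subset cl M D] or it lies in [cl M C]. If both lie in
    [cl M C], so does [D], which they cover. *)
Lemma nested_circuit_cl C D x : C \in circuits M -> D \in circuits M ->
  x \notin cl M set0 -> x \in C -> x \in cl M D ->
  C \subset cl M D \/ D \subset cl M C.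
Proof.
move=> cC cD xl xC xclD; have xE := nonloop_ground xl.
case: (boolP (x \in D)) => xD; first exact: nested_circuits_mem xC xD.
have out L : L \in circuits M -> x \in L -> L \subset x |: D ->
    C \subset cl M D \/ L \subset cl M C.
  move=> cL xL LD.
  case: (nested_circuits_mem cC cL xC xL) => [CL|]; [left|by right].
  apply: subset_cl_trans CL (subset_trans LD _).
  by rewrite subUset sub1set xclD subset_cl.
have [L [cL xL LD]] := cl_circuit xE xD xclD.
have [y yL yx] := circuit_nonloop cL xL xl.
have yD : y \in D by have := subsetP LD y yL; rewrite !inE (negPf yx).
have [L' [cL' xL' yL' L'D]] := cl_circuit_avoid cD yD xD xclD xE.
have neq : L != L' by apply: contraNneq yL' => <-.
case: (out _ cL xL LD) => [|LC]; first by left.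
case: (out _ cL' xL' L'D) => [|L'C]; first by left.
right; apply: subset_trans (circuit_cover cD cL cL' neq LD L'D xD) _.
by rewrite subUset LC.
Qed.

(** A circuit [L] through [x] inside [x |: C] is compared with [D]. If [D] is in the closure of [L],
    it is in that of [C]. Otherwise [L] lies in [cl M D] and has a nonloop [y] in [C], since [x] is
    not spanned by loops, and [y] replaces [x]. *)
Lemma nested_cl C D x : C \in circuits M -> D \in circuits M ->
  x \notin cl M set0 -> x \in cl M C -> x \in cl M D ->
  C \subset cl M D \/ D \subset cl M C.
Proof.
move=> cC cD xl xclC xclD; have xE := nonloop_ground xl.
case: (boolP (x \in C)) => xC; first exact: nested_circuit_cl xclD.
have [L [cL xL LC]] := cl_circuit xE xC xclC.
have LclC : L \subset cl M C.
  by apply: subset_trans LC _; rewrite subUset sub1set xclC subset_cl.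
case: (nested_circuit_cl cL cD xl xL xclD) => [LclD|DclL]; last first.
  by right; apply: subset_cl_trans DclL LclC.
have [y yL yl] : exists2 y, y \in L :\ x & y \notin cl M set0.
  apply/subsetPn; apply: contra xl => Ll.
  exact: subsetP (cl_sub Ll) x (circuit_cl cL xL).
have /andP[yx yL'] : (y != x) && (y \in L) by move: yL; rewrite !inE.
have yC : y \in C by have := subsetP LC y yL'; rewrite !inE (negPf yx).
exact: nested_circuit_cl yl yC (subsetP LclD y yL').
Qed.

(** The first member has rank 0 and rules out loops. Removing [cl M set0] from the other members
    separates them from it and also discards the elements outside the ground set. *)
Definition flat_family : {set {set T}} :=
  (cl M set0 :&: ground M) |: [set cl M C :\: cl M set0 | C in circuits M].

Lemma rk_clD X Y : rk M (cl M X :\: Y) <= rk M X.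
Proof.
apply: leq_trans (rkS M (subset_trans (subsetDl _ _) (subsetUr X _))) _.
by rewrite rkU_cl.
Qed.

Lemma flat_family_laminar : laminar_family flat_family.
Proof.
have dis (X Y : {set T}) : (cl M set0 :&: X) :&: (Y :\: cl M set0) = set0.
  by apply/setP => x; rewrite !inE; case: (rk M _ == _); rewrite ?andbF.
move=> X Y /setU1P[->|/imsetP[C cC ->]] /setU1P[->|/imsetP[D cD ->]].
- by left.
- by rewrite dis eqxx.
- by rewrite setIC dis eqxx.
case/set0Pn => x; rewrite !in_setI !in_setD => /and3P[/andP[xl xC] _ xD].
case: (nested_cl cC cD xl xC xD) => /cl_sub le; [left|right]; exact: setSD.
Qed.

Lemma flat_family_ground : flat_family \subset powerset (ground M).
Proof.
apply/subsetP => X /setU1P[->|/imsetP[C cC ->]]; rewrite powersetE.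
  exact: subsetIr.
by apply/subsetP => x /setDP[_ /nonloop_ground].
Qed.

(** A dependent set within all capacities has no loops, so a circuit [C] inside it lies in
    [cl M C :\: cl M set0]. The capacity of that member is at most [rk M C], one less than
    [#|C|]. *)
Lemma flat_family_indep :
  indep M = laminar_indep (ground M) flat_family (rk M).
Proof.
apply/setP => I; apply/idP/idP => [iI|].
  rewrite inE (indep_ground iI); apply/forall_inP => X _.
  by rewrite -(rk_indep (indepS iI (subsetIl I X))) rkS ?subsetIr.
rewrite inE => /andP[IE /forall_inP Ic]; apply: contraT => dI.
have [C cC CI] := dep_circuit IE dI.
have I0 : I :&: cl M set0 = set0.
  apply/eqP; rewrite -cards_eq0 -leqn0.
  rewrite -(setIidPl IE) -setIA [ground M :&: _]setIC.
  apply: leq_trans (Ic _ (setU11 _ _)) _.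
  apply: leq_trans (rkS M (subset_trans (subsetIl _ _) (subsetUr set0 _))) _.
  by rewrite rkU_cl // rk0.
have := Ic _ (setU1r _ (imset_f _ cC)).
rewrite leqNgt => /negP[]; apply: leq_ltn_trans (rk_clD _ _) _.
rewrite (rk_circuit cC); apply/subset_leq_card/subsetP => x xC.
rewrite inE (subsetP CI) // inE (subsetP (subset_cl M C)) // andbT.
by apply: contraTN (subsetP CI x xC) => xl; apply/negP => xI;
  have := in_set0 x; rewrite -I0 inE xI xl.
Qed.

End NestedClosures.

(** * Isomorphisms as functions on the carrier types *)

Lemma isomorphic_inj (T T' : finType) (M : matroid T) (N : matroid T')
    (g : T -> T') :
  {in ground M &, injective g} -> g @: ground M = ground N ->
  (forall I : {set T}, I \subset ground M ->
    (I \in indep M) = (g @: I \in indep N)) ->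
  isomorphic M N.
Proof.
move=> injg gE gI.
have gN (u : {x : T | x \in ground M}) : g (val u) \in ground N.
  by rewrite -gE imset_f // (valP u).
pose f u : {y : T' | y \in ground N} := Sub (g (val u)) (gN u).
exists f.
  apply: inj_card_bij => [u v /(congr1 val) /= e|].
    by apply: val_inj; apply: injg e; apply: valP.
  by rewrite !card_sig -gE card_in_imset // leqnn.
move=> I; rewrite gI; last by apply/subsetP => _ /imsetP[u _ ->]; apply: valP.
by rewrite -!imset_comp.
Qed.

Lemma isomorphic_sym (T T' : finType) (M : matroid T) (N : matroid T') :
  isomorphic M N -> isomorphic N M.
Proof.
case=> f [f' fK f'K] fI; exists f'; first by exists f.
move=> I; rewrite fI.
suff -> : [set f x | x in [set f' y | y in I]] = I by [].
by rewrite -imset_comp (eq_imset _ f'K) imset_id.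
Qed.

(* Without a point x0 in the ground set, T' could be empty and T not.         *)
Lemma isomorphic_fun (T T' : finType) (M : matroid T) (N : matroid T') x0 :
  x0 \in ground M -> isomorphic M N -> exists g : T -> T',
    [/\ {in ground M &, injective g}, g @: ground M = ground N
      & forall I : {set T}, I \subset ground M ->
          (I \in indep M) = (g @: I \in indep N)].
Proof.
move=> x0M [f [f' fK f'K] fI].
pose g x := val (f (insubd (Sub x0 x0M) x)).
have gE u : g (val u) = val (f u) by rewrite /g valKd.
have inE' x : x \in ground M -> exists u : {x : T | x \in ground M}, x = val u.
  by move=> xM; exists (Sub x xM).
exists g; split=> [x y /inE'[u ->] /inE'[v ->]||I IE].
- by rewrite !gE => /val_inj/(can_inj fK)->.
- apply/setP => y; apply/imsetP/idP => [[_ /inE'[u ->] ->]|yN].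
    by rewrite gE; apply: valP.
  by exists (val (f' (Sub y yN))); [apply: valP | rewrite gE f'K].
pose I' : {set {x : T | x \in ground M}} := [set u | val u \in I].
have eI : I = [set val u | u in I'].
  apply/setP => x; apply/idP/imsetP => [xI|[u]]; last by rewrite inE => ? ->.
  by have [u e] := inE' x (subsetP IE x xI); exists u; rewrite // inE -e.
by rewrite [in LHS]eI fI eI -!imset_comp (eq_imset _ gE).
Qed.

(** * Contraction, in particular of a single nonloop *)

Section Contraction.
Variables (T : finType) (M : matroid T).
Implicit Types (B C D I X Y : {set T}) (f : T).

Lemma basis_contraction_indep C B I : basis_of_set M C B ->
  (I \in indep (contraction M C)) =
  (I \subset ground M :\: C) && (I :|: B \in indep M).
Proof.
move=> bB; rewrite inE; case: (boolP (I \subset _)) => //= IE.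
apply/existsP/idP => [[B' /andP[bB']]|iB]; last by exists B; rewrite bB.
by apply: basis_exchange bB' bB; move: IE; rewrite subsetD => /andP[].
Qed.

Lemma basis_of_set_ex C : exists B, basis_of_set M C B.
Proof.
have [|B bB _] := @maxset_exists T
  (fun X : {set T} => (X \in indep M) && (X \subset C)) set0.
  by rewrite indep0 sub0set.
by exists B.
Qed.

Lemma indep_basis_of_set C : C \in indep M -> basis_of_set M C C.
Proof.
move=> iC; apply/maxsetP; rewrite iC subxx; split=> // X /andP[_ XC] CX.
by apply/eqP; rewrite eqEsubset XC.
Qed.

Variable f : T.
Hypothesis indf : [set f] \in indep M.
Let N := contraction M [set f].

Lemma contraction1_indep I :
  (I \in indep N) = (f \notin I) && (f |: I \in indep M).
Proof.
rewrite (basis_contraction_indep _ (indep_basis_of_set indf)) setUC subsetD1.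
case: (boolP (f |: I \in indep M)) => [fI|_]; last by rewrite !andbF.
by rewrite (subset_trans (subsetUr [set f] I) (indep_ground fI)).
Qed.

Lemma contraction1_rk X : f \notin X -> (rk N X).+1 = rk M (f |: X).
Proof.
move=> fX; apply/eqP; rewrite eqn_leq; apply/andP; split.
  have [I [iI _ IX <-]] := rk_extend (indep0 N) (sub0set X).
  move: iI; rewrite contraction1_indep => /andP[fI iI].
  apply: leq_trans (indep_leq_rk iI (setUS _ IX)).
  by rewrite cardsU1 fI.
have [|J [iJ fJ JX <-]] := rk_extend indf (X := f |: X).
  by rewrite sub1set setU11.
rewrite sub1set in fJ.
rewrite (cardsD1 f) fJ ltnS; apply: indep_leq_rk.
  by rewrite contraction1_indep !inE eqxx setD1K.
by rewrite subDset.
Qed.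

Lemma contraction1_sub_cl X Y : f \notin X -> f \notin Y ->
  (Y \subset cl N X) = (Y \subset cl M (f |: X)).
Proof.
move=> fX fY; rewrite !sub_cl -ltnS !contraction1_rk // ?setUA //.
by rewrite inE negb_or fX.
Qed.

Lemma contraction1_circuit_in C : C \in circuits M -> f \in C ->
  C :\ f \in circuits N.
Proof.
move=> cC fC; have /circuitP[CE Cd Ci] := cC.
apply/circuitP; split=> [||x /setD1P[xf xC]].
- exact: setSD.
- by rewrite contraction1_indep setD1K // (negPf Cd) andbF.
rewrite contraction1_indep !inE eqxx andbF /=.
apply: indepS (Ci x xC) _; apply/subsetP => y; rewrite !inE.
by case: (eqVneq y f) => [->|_] /=; rewrite 1?eq_sym ?xf.
Qed.

(** Since [f] is not spanned by [C], adding it to any independent [C :\ x] keeps that set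
    independent. *)
Lemma contraction1_circuit_out C : C \in circuits M -> f \notin cl M C ->
  C \in circuits N.
Proof.
move=> cC fC; have /circuitP[CE Cd Ci] := cC.
have fnC : f \notin C by apply: contra fC; apply: subsetP (subset_cl M C) f.
apply/circuitP; split=> [||x xC].
- by rewrite subsetD1 CE.
- rewrite contraction1_indep fnC; apply: contra Cd => /indepS; apply.
  exact: subsetUr.
rewrite contraction1_indep inE (negPf fnC) andbF /= indepE.
have fnCx : f \notin C :\ x by rewrite inE (negPf fnC) andbF.
rewrite eqn_leq rk_card cardsU1 fnCx -(rk_indep (Ci x xC)) add1n ltnNge -mem_cl.
by apply: contra fC; apply: subsetP (clS _ (subsetDl _ _)) f.
Qed.

End Contraction.

(* M has a minor M / K restricted to C1 :|: C2 which is the paving matroid    *)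
(* Y r, described by its two circuit-hyperplanes C1 and C2.                   *)
Definition Y_config (T : finType) (M : matroid T) (r : nat)
    (K C1 C2 : {set T}) : Prop :=
  [/\ K :|: (C1 :|: C2) \subset ground M, [disjoint K & C1 :|: C2],
      [/\ #|C1| = r, #|C2| = r & #|C1 :&: C2| = 1] & forall I : {set T},
      I \subset C1 :|: C2 -> (I :|: K \in indep M) =
        [&& #|I| <= r, ~~ (C1 \subset I) & ~~ (C2 \subset I)]].

(** A violation of [nested_circuits]. *)
Definition crossing (T : finType) (M : matroid T) (C1 C2 : {set T}) : Prop :=
  [/\ C1 \in circuits M, C2 \in circuits M, exists2 e, e \in C1 & e \in C2,
      ~~ (C1 \subset cl M C2) & ~~ (C2 \subset cl M C1)].

Lemma crossingC (T : finType) (M : matroid T) C1 C2 :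
  crossing M C1 C2 -> crossing M C2 C1.
Proof. by case=> ? ? [e ? ?] ? ?; split=> //; exists e. Qed.

(** * Crossings in a matroid none of whose nonloop contractions has one *)

Section MinimalCrossing.
Variables (T : finType) (M : matroid T).
Hypothesis minM : forall f C1 C2, [set f] \in indep M ->
  ~ crossing (contraction M [set f]) C1 C2.
Implicit Types (C D : {set T}) (e f x : T).

(** With two common elements, contracting [f] would leave a crossing: the circuits [C1 :\ f] and
    [C2 :\ f] still meet in [e], and their closure relations are those of [C1] and [C2]. *)
Lemma crossing_uniq (C1 C2 : {set T}) e f : crossing M C1 C2 ->
  e \in C1 -> e \in C2 -> f \in C1 -> f \in C2 -> e = f.
Proof.
move=> [c1 c2 _ n12 n21] e1 e2 f1 f2; apply: contraTeq isT => ef.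
have indf : [set f] \in indep M.
  by apply: indepS (circuitD1 c1 e1) _; rewrite sub1set !inE eq_sym ef.
have nest C D : f \in C -> f \in D ->
    (C :\ f \subset cl (contraction M [set f]) (D :\ f)) = (C \subset cl M D).
  move=> fC fD; rewrite contraction1_sub_cl ?inE ?eqxx // setD1K //.
  rewrite -{2}(setD1K fC) subUset sub1set.
  by rewrite (subsetP (subset_cl M D) f fD).
case: (minM (f := f) (C1 := C1 :\ f) (C2 := C2 :\ f) indf); split.
- exact: contraction1_circuit_in.
- exact: contraction1_circuit_in.
- by exists e; rewrite !inE ef.
- by rewrite nest.
- by rewrite nest.
Qed.

(** Contract some [f] in [C1] outside [cl M C2]. The circuits [C1 :\ f] and [C2] still meet, so they
    must be nested. As [C2] is not in [cl M C1], this means that [C1] lies in [cl M (f |: C2)], so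
    the union has rank exactly one more than [C2]. *)
Lemma crossing_card (C1 C2 : {set T}) : crossing M C1 C2 ->
  #|C2| = rk M (C1 :|: C2).
Proof.
move=> [c1 c2 [e e1 e2] n12 n21]; have /subsetPn[f f1 f2] := n12.
have fl : f \notin cl M set0.
  by apply: contra f2; apply: subsetP (clS M (sub0set _)) f.
have fC2 : f \notin C2 by apply: contra f2; apply: subsetP (subset_cl M C2) f.
have indf := nonloop_indep fl.
have ef : e != f by apply: contraNneq fC2 => <-.
apply/eqP; rewrite eqn_leq -(rk_circuit c2) setUC ltnNge -sub_cl n12 /=.
have sub : C1 \subset cl M (f |: C2).
  apply: contraT => nsub.
  case: (minM (f := f) (C1 := C1 :\ f) (C2 := C2) indf); split.
  - exact: contraction1_circuit_in.
  - exact: contraction1_circuit_out.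
  - by exists e; rewrite // !inE ef.
  - rewrite contraction1_sub_cl ?inE ?eqxx //.
    apply: contra nsub => sub; rewrite -(setD1K f1) subUset sub.
    by rewrite sub1set (subsetP (subset_cl M _)) ?setU11.
  - by rewrite contraction1_sub_cl ?inE ?eqxx // setD1K.
apply: leq_trans (rkU1 M f C2); rewrite -(rkU_cl sub) rkS //.
by rewrite setSU ?subsetUr.
Qed.

Lemma crossing_cardC (C1 C2 : {set T}) : crossing M C1 C2 -> #|C1| = #|C2|.
Proof.
move=> V; rewrite (crossing_card V) setUC -crossing_card //.
exact: crossingC.
Qed.

(* A crossing partner D of C1 inside f |: C2 must be C2 with e exchanged for  *)
(* f; two circuits through f avoiding suitable z and z' of C2 are not of that *)
(* form, so they lie in cl C1, and they cover C2.                             *)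
Lemma crossing_cl (C1 C2 : {set T}) f : crossing M C1 C2 ->
  f \in C1 -> f \in cl M C2 -> f \in C2.
Proof.
move=> V f1 fcl; have [c1 c2 [e e1 e2] n12 n21] := V.
apply: contraT => f2.
have ef : e != f by apply: contraNneq f2 => <-.
have fE : f \in ground M by rewrite (subsetP (circuit_ground c1)).
have subcl D : D \subset f |: C2 -> D \subset cl M C2.
  by move=> /subset_trans; apply; rewrite subUset sub1set fcl subset_cl.
have out D z : D \in circuits M -> f \in D -> D \subset f |: C2 ->
    z \in C2 -> z != e -> z \notin D -> D \subset cl M C1.
  move=> cD fD DC2 z2 ze zD; apply: contraT => nD.
  have VD : crossing M C1 D.
    split=> //; first by exists f.
    by apply: contra n12 => /subset_cl_trans; apply; apply: subcl.
  have eD : e \notin D.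
    by apply: contra ef => eD; apply/eqP; apply: crossing_uniq VD _ _ _ _.
  (* Since [D] misses both [e] and [z], it has fewer elements than [C2], while the two crossings
     give [D], [C1] and [C2] equal sizes. *)
  have : #|D| <= #|f |: (C2 :\ e :\ z)|.
    apply/subset_leq_card/subsetP => y yD; have := subsetP DC2 y yD.
    rewrite !inE; case: (eqVneq y f) => //= yf ->.
    by rewrite andbT; apply/andP; split;
      [apply: contraNneq zD => <- | apply: contraNneq eD => <-].
  rewrite -(crossing_cardC VD) (crossing_cardC V) cardsU1.
  rewrite (cardsD1 e C2) (cardsD1 z (C2 :\ e)) e2 !inE ze z2 (negPf f2) !andbF.
  by rewrite ltnn.
have [z z2 ze] : exists2 z, z \in C2 & z != e.
  have /subsetPn[z z2 z1] := n21.
  exists z => //; apply: contraNneq z1 => ->.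
  exact: subsetP (subset_cl _ _) _ e1.
have [D [cD fD zD DC2]] := cl_circuit_avoid c2 z2 f2 fcl fE.
(* Otherwise [D] consists of [e] and [f] at most. Both lie in [cl M C2], so [D] is inside the
   independent set [C1 :\ x] for any [x] in [C1] outside that closure. *)
have [z' z'D /norP[z'e z'f]] :
    exists2 z', z' \in D & ~~ ((z' == e) || (z' == f)).
  have /subsetPn[x x1 x2] := n12.
  have xe : x != e.
    by apply: contraNneq x2 => ->; apply: subsetP (subset_cl _ _) _ e2.
  have xf : x != f by apply: contraNneq x2 => ->.
  apply/exists_inP; apply: contraR (circuit_dep cD).
  rewrite negb_exists_in => /forall_inP Def; apply: indepS (circuitD1 c1 x1) _.
  apply/subsetP => y /Def; rewrite negbK !inE => /orP[]/eqP->.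
    by rewrite eq_sym xe.
  by rewrite eq_sym xf.
have z'2 : z' \in C2 by have := subsetP DC2 _ z'D; rewrite !inE (negPf z'f).
have [D' [cD' fD' z'D' D'C2]] := cl_circuit_avoid c2 z'2 f2 fcl fE.
have neq : D != D' by apply: contraNneq z'D' => <-.
case/negP: n21; apply: subset_trans (circuit_cover c2 cD cD' neq DC2 D'C2 f2) _.
by rewrite subUset (out D z) // (out D' z').
Qed.

(** A circuit cannot have exactly one element outside the closure of [C2], so [C1] has two there,
    besides the common element [e]. *)
Lemma crossing_gt2 (C1 C2 : {set T}) : crossing M C1 C2 -> 2 < #|C1|.
Proof.
move=> [c1 c2 [e e1 e2] n12 _]; have /subsetPn[x x1 x2] := n12.
have /subsetPn[y y1 y2] : ~~ (C1 :\ x \subset cl M C2).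
  by apply: contra x2 => /cl_sub/subsetP; apply; apply: circuit_cl.
have eC2 := subsetP (subset_cl M C2) e e2.
have ex : e != x by apply: contraNneq x2 => <-.
have ey : e != y by apply: contraNneq y2 => <-.
have /andP[yx y1'] : (y != x) && (y \in C1) by move: y1; rewrite !inE.
rewrite (cardsD1 e) (cardsD1 x) (cardsD1 y) !inE e1 x1 y1' yx.
by rewrite eq_sym ex eq_sym ey.
Qed.

(** A further circuit [D] contains elements of both differences, and by [crossing_cl] and its size
    it crosses both [C1] and [C2]. Then it meets each in at most one element, so [#|D| <= 2],
    against [crossing_gt2]. *)
Lemma crossing_circuit (C1 C2 D : {set T}) : crossing M C1 C2 ->
  D \in circuits M -> D \subset C1 :|: C2 -> #|D| <= #|C1| -> D = C1 \/ D = C2.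
Proof.
move=> V cD DC le; have V' := crossingC V; have [c1 c2 _ n12 n21] := V.
case: (boolP (D \subset C1)) => [/(circuit_sub c1 cD)|]; first by left.
case: (boolP (D \subset C2)) => [/(circuit_sub c2 cD)|]; first by right.
move=> /subsetPn[d2 d2D d2C2] /subsetPn[d1 d1D d1C1]; exfalso.
have d1C2 : d1 \in C2 by move: (subsetP DC _ d1D); rewrite inE (negPf d1C1).
have d2C1 : d2 \in C1.
  by move: (subsetP DC _ d2D); rewrite inE (negPf d2C2) orbF.
have key A B d d' : crossing M A B -> #|D| <= #|A| -> d \in D -> d \in B ->
    d \notin A -> d' \in D -> d' \in A -> crossing M A D.
  move=> VA leA dD dB dA d'D d'A; have [cA _ _ _ _] := VA.
  have nD : ~~ (D \subset cl M A).
    apply: contra dA => /subsetP/(_ d dD) dcl.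
    exact: crossing_cl (crossingC VA) dB dcl.
  (* If [A] were in [cl M D], the union would have the rank of [D]. As [D] is not in [cl M A], that
     rank exceeds the rank of [A], so [D] would be larger than [A]. *)
  split=> //; first by exists d'.
  apply/negP => /rkU_cl eD; move: nD; rewrite sub_cl -ltnNge setUC eD.
  by rewrite -ltnS !rk_circuit // ltnNge leA.
have V1 := key _ _ d1 d2 V le d1D d1C2 d1C1 d2D d2C1.
have V2 := key _ _ d2 d1 V' _ d2D d2C1 d2C2 d1D d1C2.
rewrite -(crossing_cardC V) in V2; have {}V2 := V2 le.
have le1 A : crossing M A D -> #|D :&: A| <= 1.
  move=> VA; apply/card_le1_eqP => x y /setIP[xD xA] /setIP[yD yA].
  exact: crossing_uniq VA _ _ _ _.
have := crossing_gt2 V; rewrite (crossing_cardC V1) -(setIidPl DC) setIUr.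
have [+ _] := leq_card_setU (D :&: C1) (D :&: C2).
by move: (le1 _ V1) (le1 _ V2); lia.
Qed.

Lemma crossing_Y_config (C1 C2 : {set T}) : crossing M C1 C2 ->
  Y_config M #|C1| set0 C1 C2.
Proof.
move=> V; have [c1 c2 [e e1 e2] _ _] := V.
have sE : C1 :|: C2 \subset ground M by rewrite subUset !circuit_ground.
split.
- by rewrite set0U.
- by rewrite -setI_eq0 set0I.
- split=> //; first by rewrite (crossing_cardC V).
  apply/eqP/cards1P; exists e; apply/setP => x; rewrite !inE.
  apply/andP/eqP => [[x1 x2]|->//]; exact: crossing_uniq V _ _ _ _.
move=> I IC; rewrite setU0; apply/idP/and3P => [iI|[le n1 n2]].
  split.
  - rewrite (crossing_cardC V) (crossing_card V) -(rk_indep iI); exact: rkS.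
  - by apply: contra (circuit_dep c1) => /(indepS iI).
  - by apply: contra (circuit_dep c2) => /(indepS iI).
apply: contraT => /(dep_circuit (subset_trans IC sE))[D cD DI].
case: (crossing_circuit V cD (subset_trans DI IC)) => [|e1'|e2'].
- exact: leq_trans (subset_leq_card DI) le.
- by rewrite -e1' DI in n1.
- by rewrite -e2' DI in n2.
Qed.

End MinimalCrossing.

(** * Reduction of an arbitrary crossing to a minimal one *)

Definition crossingb (T : finType) (M : matroid T) (C1 C2 : {set T}) :=
  [&& C1 \in circuits M, C2 \in circuits M, C1 :&: C2 != set0,
      ~~ (C1 \subset cl M C2) & ~~ (C2 \subset cl M C1)].

Lemma crossingP (T : finType) (M : matroid T) (C1 C2 : {set T}) :
  reflect (crossing M C1 C2) (crossingb M C1 C2).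
Proof.
apply: (iffP and5P) => -[c1 c2 meet n12 n21]; split=> //.
  by case/set0Pn: meet => e /setIP[e1 e2]; exists e.
by apply/set0Pn; case: meet => e e1 e2; exists e; rewrite inE e1.
Qed.

Lemma contraction1_Y_config (T : finType) (M : matroid T) (f : T) r
    (K C1 C2 : {set T}) : [set f] \in indep M ->
  Y_config (contraction M [set f]) r K C1 C2 -> Y_config M r (f |: K) C1 C2.
Proof.
move=> indf [/= sE dis crd cfg].
move: sE; rewrite subsetD1 !inE !negb_or => /andP[sE /and3P[fK f1 f2]].
split=> //.
- rewrite -setUA subUset sE andbT; exact: indep_ground.
- rewrite -setI_eq0 setIUl setU_eq0 !setI_eq0 disjoints1 dis.
  by rewrite inE negb_or f1 f2.
move=> I IC; rewrite -cfg // contraction1_indep // setUCA inE negb_or fK andbT.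
suff -> : f \notin I by [].
by apply: contra f1 => /(subsetP IC); rewrite inE (negPf f2) orbF.
Qed.

(** Induction on the size of the ground set: contract a nonloop whenever some crossing survives
    there, and collect the contracted elements in [K]. *)
Lemma crossing_minor (T : finType) (M : matroid T) (C1 C2 : {set T}) :
  crossing M C1 C2 -> exists r K D1 D2, 2 < r /\ Y_config M r K D1 D2.
Proof.
elim: {M}_.+1 {-2}M (ltnSn #|ground M|) C1 C2 => // n IHn M ltn C1 C2 V.
pose b f (D : {set T} * {set T}) :=
  ([set f] \in indep M) && crossingb (contraction M [set f]) D.1 D.2.
case: (boolP [exists f, [exists D, b f D]]) => [|no].
  case/existsP=> f /existsP[[D1 D2] /andP[indf /= /crossingP Vf]].
  have [|r [K [E1 [E2 [r2 cfg]]]]] := IHn (contraction M [set f]) _ _ _ Vf.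
    move: ltn; rewrite (cardsD1 f) -sub1set (indep_ground indf); exact.
  exists r, (f |: K), E1, E2; split=> //; exact: contraction1_Y_config.
have minM f D1 D2 : [set f] \in indep M ->
    ~ crossing (contraction M [set f]) D1 D2.
  move=> indf Vf; case/negP: no; apply/existsP; exists f; apply/existsP.
  by exists (D1, D2); rewrite /b indf; apply/crossingP.
exists #|C1|, set0, C1, C2; split; first exact: crossing_gt2 V.
exact: crossing_Y_config minM _ _ V.
Qed.

(** * [Y r] described by its two circuits of size [r], and as a minor *)

Lemma card_Y_ground1 r : 0 < r -> #|Y_ground1 r| = r.
Proof.
move=> r0; rewrite cardsU1 card_imset; last by move=> i j [].
rewrite card_ord; case: imsetP => [[]//|_]; exact: prednK.
Qed.

Lemma card_Y_ground2 r : 0 < r -> #|Y_ground2 r| = r.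
Proof.
move=> r0; rewrite cardsU1 card_imset; last by move=> i j [].
rewrite card_ord; case: imsetP => [[]//|_]; exact: prednK.
Qed.

Lemma Y_groundT r : Y_ground1 r :|: Y_ground2 r = setT.
Proof.
apply/setP => -[[i|i]|]; rewrite !inE //= ?imset_f ?orbT //.
Qed.

(** The third circuit of the parallel connection, the union without the basepoint, has [2 * r - 2]
    elements. This exceeds [r] because [3 <= r], so the truncation already excludes it. *)
Lemma Y_indep r (r3 : 3 <= r) (J : {set Y_carrier r}) :
  (J \in indep (Y r3)) =
  [&& #|J| <= r, ~~ (Y_ground1 r \subset J) & ~~ (Y_ground2 r \subset J)].
Proof.
have r0 : 0 < r := ltnW (ltnW r3).
have le (G : {set Y_carrier r}) : #|G| = r ->
    (#|J :&: G| <= r.-1) = ~~ (G \subset J).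
  move=> cG; rewrite -ltnS prednK //.
  have -> : (#|J :&: G| < r) = (#|J :&: G| < #|G|) by rewrite cG.
  apply/idP/idP.
    by apply: contraL => GJ; rewrite (setIidPr GJ) ltnn.
  move=> GJ; apply: proper_card; rewrite properE subsetIr /=.
  by apply: contra GJ; rewrite subsetI => /andP[].
have unif (G X : {set Y_carrier r}) : X \subset G ->
    (X \in uniform_indep G r.-1) = (#|X| <= r.-1).
  by move=> XG; rewrite inE XG.
have sub1U (G : {set Y_carrier r}) : None \in G -> None |: J :&: G \subset G.
  by rewrite subUset sub1set subsetIr andbT.
rewrite inE parallel_indep_cond ?Y_nonloop1 ?Y_nonloop2 // /parallel_cond.
rewrite (_ : ground _ :|: ground _ = setT) ?Y_groundT // subsetT /=.
rewrite !unif ?sub1U ?subsetIr ?setU11 //.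
rewrite !le ?card_Y_ground1 ?card_Y_ground2 //.
rewrite andbC; case: (leqP #|J| r) => //= cJ.
case: (boolP (Y_ground1 r \subset J)) => //= n1.
case: (boolP (Y_ground2 r \subset J)) => //= n2.
have cU : #|J :&: Y_ground1 r| + #|J :&: Y_ground2 r| = #|J| + (None \in J).
  apply: (parallel_card (N1 := Y_circuit1 r) (N2 := Y_circuit2 r)).
    exact: Y_groundI.
  by rewrite /= Y_groundT subsetT.
move: n1 n2; rewrite -(le _ (card_Y_ground1 r0)) -(le _ (card_Y_ground2 r0)).
move: cU; rewrite !cardsU1 !inE /= !andbT.
by case: (None \in J) => /= ; lia.
Qed.

Lemma Y_configC (T : finType) (M : matroid T) r (K C1 C2 : {set T}) :
  Y_config M r K C1 C2 -> Y_config M r K C2 C1.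
Proof.
case=> sE dis [c1 c2 c12] cfg.
rewrite /Y_config [C2 :|: C1]setUC [C2 :&: C1]setIC; split=> // I IC.
by rewrite cfg // (andbC (~~ (C1 \subset I))).
Qed.

(** The set [K] is a basis [B] of the contracted set rather than that set itself, which may be
    dependent. *)
Lemma minor_Y_config (T : finType) (M : matroid T) r (r3 : 3 <= r) :
  has_minor M (Y r3) -> exists K C1 C2, Y_config M r K C1 C2.
Proof.
case=> C [D [CE _ _ /isomorphic_sym iso]].
have r0 : 0 < r := ltnW (ltnW r3).
have YT : ground (Y r3) = setT := Y_groundT r.
have [|g [gi gE gI]] := isomorphic_fun (x0 := None) _ iso; first by rewrite YT.
rewrite YT /= in gi gE gI.
have {}gi : injective g by move=> x y; apply: gi; rewrite in_setT.
have [B bB] := basis_of_set_ex M C.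
have /andP[iB BC] := maxsetp bB.
have gD y : g y \in ground M :\: C :\: D by rewrite -gE imset_f.
have gC (J : {set Y_carrier r}) : g @: J \subset ground M :\: C.
  by apply/subsetP => _ /imsetP[y _ ->]; have /setDP[] := gD y.
exists B, (g @: Y_ground1 r), (g @: Y_ground2 r); rewrite /Y_config -imsetU.
rewrite Y_groundT; split.
- rewrite subUset indep_ground //=.
  exact: subset_trans (gC _) (subsetDl _ _).
- by have := gC setT; rewrite subsetD disjoint_sym => /andP[_ /(disjointWl BC)].
- rewrite -imsetI; last by move=> x y _ _; apply: gi.
  rewrite !card_imset // card_Y_ground1 // card_Y_ground2 //.
  by have -> := Y_groundI r; rewrite cards1.
move=> I IC.
have eI : I = g @: (g @^-1: I).
  apply/setP => x; apply/idP/imsetP => [xI|[y]]; last by rewrite inE => ? ->.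
  by have /imsetP[y _ e] := subsetP IC x xI; exists y; rewrite // inE -e.
rewrite !sub_imset_pre [in #|I|]eI card_imset // -Y_indep gI ?subsetT // -eI.
have IMC : I \subset ground M :\: C by rewrite eI.
by rewrite [RHS]inE (basis_contraction_indep _ bB) IMC /= -gE IC andbT.
Qed.

Lemma Y_config_minor (T : finType) (M : matroid T) r (r3 : 3 <= r)
  (K C1 C2 : {set T}) : Y_config M r K C1 C2 -> has_minor M (Y r3).
Proof.
case=> sE dis [c1 c2 /eqP/cards1P[e e12]] cfg.
have r0 : 0 < r := ltnW (ltnW r3).
have [e1 e2] : e \in C1 /\ e \in C2 by apply/setIP; rewrite e12 set11.
have iK : K \in indep M.
  rewrite -[K]set0U cfg ?sub0set // cards0 !subset0.
  by apply/and3P; split=> //; apply: contraTneq r0 => C0;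
    [rewrite -c1 C0 cards0 | rewrite -c2 C0 cards0].
(* The basepoint goes to the common element, and the two copies of ['I_r.-1] enumerate the rest of
   [C1] and of [C2]. The default [e] of [nth] is never reached, as both lists have length [r.-1]. *)
pose g (y : Y_carrier r) := match y with
  | None => e
  | Some (inl i) => nth e (enum (C1 :\ e)) i
  | Some (inr i) => nth e (enum (C2 :\ e)) i end.
have sz (C : {set T}) : #|C| = r -> e \in C -> size (enum (C :\ e)) = r.-1.
  by move=> <- eC; rewrite -cardE (cardsD1 e C) eC.
have nthC (C : {set T}) i : #|C| = r -> e \in C -> i < r.-1 ->
    nth e (enum (C :\ e)) i \in C.
  move=> cC eC lti; have := mem_nth e (s := enum (C :\ e)) (n := i).
  by rewrite sz // => /(_ lti); rewrite mem_enum => /setD1P[].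
have idx (C : {set T}) x : #|C| = r -> e \in C -> x \in C -> x != e ->
    exists i : 'I_r.-1, x = nth e (enum (C :\ e)) i.
  move=> cC eC xC xe; have xs : x \in enum (C :\ e) by rewrite mem_enum !inE xe.
  have lt : index x (enum (C :\ e)) < r.-1 by rewrite -(sz C) // index_mem.
  by exists (Ordinal lt); rewrite nth_index.
have g1 : g @: Y_ground1 r = C1.
  apply/setP => x; apply/imsetP/idP => [[y + ->]|x1].
    by case/setU1P => [->|/imsetP[i _ ->]] //=; apply: nthC.
  case: (eqVneq x e) => [->|xe]; first by exists None; rewrite // setU11.
  have [i ->] := idx C1 x c1 e1 x1 xe.
  by exists (Some (inl i)); rewrite // setU1r ?imset_f.
have g2 : g @: Y_ground2 r = C2.
  apply/setP => x; apply/imsetP/idP => [[y + ->]|x2].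
    by case/setU1P => [->|/imsetP[i _ ->]] //=; apply: nthC.
  case: (eqVneq x e) => [->|xe]; first by exists None; rewrite // setU11.
  have [i ->] := idx C2 x c2 e2 x2 xe.
  by exists (Some (inr i)); rewrite // setU1r ?imset_f.
have gT : g @: setT = C1 :|: C2 by rewrite -Y_groundT imsetU g1 g2.
(* By counting: the image [C1 :|: C2] and the carrier both have [r + r - 1] elements. *)
have gi : injective g.
  suff /imset_injP gi : #|g @: setT| == #|[set: Y_carrier r]|.
    by move=> x y; apply: gi; rewrite in_setT.
  rewrite gT -Y_groundT (cardsU C1) (cardsU (Y_ground1 r)).
  rewrite card_Y_ground1 // card_Y_ground2 // c1 c2 e12.
  by have -> := Y_groundI r; rewrite !cards1.
exists K, (ground M :\: K :\: (C1 :|: C2)).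
have [KE CE] : K \subset ground M /\ C1 :|: C2 \subset ground M.
  by apply/andP; rewrite -subUset.
have CK : C1 :|: C2 \subset ground M :\: K.
  by rewrite subsetD CE disjoint_sym.
split=> //.
- exact: subset_trans (subsetDl _ _) (subsetDl _ _).
- rewrite disjoint_sym (disjointWl (subsetDl _ _)) // disjoints_subset setDE.
  exact: subsetIr.
have gE : ground M :\: K :\: (ground M :\: K :\: (C1 :|: C2)) = C1 :|: C2.
  by rewrite setDDr setDv set0U; apply/setIidPr.
apply/isomorphic_sym/(isomorphic_inj (g := g)).
- by move=> x y _ _; apply: gi.
- by rewrite /= gE Y_groundT gT.
move=> J _; rewrite Y_indep [RHS]inE /= gE.
have JC : g @: J \subset C1 :|: C2 by rewrite -gT imsetS ?subsetT.
rewrite (basis_contraction_indep _ (indep_basis_of_set iK)) JC andbT.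
rewrite (subset_trans JC CK) cfg // card_imset // -g1 -g2 !sub_imset_pre.
have -> // : g @^-1: (g @: J) = J.
by apply/setP => y; rewrite inE mem_imset.
Qed.

(** * Laminar matroids have no [Y_config] *)

Lemma laminar_Y_config (T : finType) (M : matroid T) r (K C1 C2 : {set T}) :
  2 < r -> laminar M -> Y_config M r K C1 C2 -> False.
Proof.
move=> r2 [T' [E [A [c [lamA [_ iso]]]]]] cfg0.
have [sE _ [_ _ /eqP/cards1P[e e12]] _] := cfg0.
have [e1 e2] : e \in C1 /\ e \in C2 by apply/setIP; rewrite e12 set11.
have eE : e \in ground M by rewrite (subsetP sE) // !inE e1 orbT.
have [g [gi /= gE gI]] := isomorphic_fun eE iso.
have gIc (I : {set T}) : I \subset ground M ->
    (I \in indep M) = [forall X in A, #|g @: I :&: X| <= c X].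
  by move=> IE; rewrite gI // inE -gE imsetS.
have witness (D1 D2 : {set T}) : Y_config M r K D1 D2 -> exists X,
    [/\ X \in A, g @: D1 \subset X & c X < #|g @: (D1 :|: K) :&: X|].
  case=> sD dis [c1 c2 _] cfg.
  have sub (I : {set T}) : I \subset D1 -> I :|: K \subset ground M.
    move=> ID; apply: subset_trans sD; rewrite setUC setUS //.
    exact: subset_trans ID (subsetUl _ _).
  have: D1 :|: K \notin indep M by rewrite cfg ?subsetUl // subxx andbF.
  rewrite gIc ?sub // negb_forall_in => /exists_inP[X XA].
  rewrite -ltnNge => cX.
  (* If [g x] were outside [X], removing [x] would not lower the count in [X], yet [D1 :\ x] is
     independent over [K]. *)
  exists X; split=> //; apply/subsetP => _ /imsetP[x x1 ->].
  apply: contraLR cX => gxX; rewrite -leqNgt.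
  have := cfg (D1 :\ x); rewrite (subset_trans (subsetDl _ _) (subsetUl _ _)).
  have cx : #|D1 :\ x| < r by rewrite -c1 (cardsD1 x D1) x1.
  have nD (C : {set T}) : #|C| = r -> ~~ (C \subset D1 :\ x).
    by move=> cC; apply: contraL cx => /subset_leq_card; rewrite cC -leqNgt.
  rewrite (ltnW cx) !nD // gIc ?sub ?subsetDl //.
  move=> /(_ isT) /forall_inP/(_ X XA); apply: leq_trans.
  apply/subset_leq_card/subsetP => z /setIP[/imsetP[y yDK ->] yX].
  rewrite inE yX andbT imset_f // !inE; move: yDK; rewrite inE.
  by case: (eqVneq y x) => // yx; rewrite yx (negPf gxX) in yX.
have [X [XA X1 cX]] := witness _ _ cfg0.
have [X' [XA' X2 cX']] := witness _ _ (Y_configC cfg0).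
have meet : X :&: X' != set0.
  apply/set0Pn; exists (g e); apply/setIP.
  by split; [apply: (subsetP X1) | apply: (subsetP X2)]; apply: imset_f.
(* Both witnesses contain [g e], so laminarity makes them comparable, and the two circuits play
   symmetric roles. *)
wlog XX' : C1 C2 X X' cfg0 sE e12 e1 e2 XA X1 cX XA' X2 cX' meet / X \subset X'.
  move=> wl; case: (lamA X X' XA XA' meet) => sub.
    exact: (wl C1 C2 X X').
  apply: (wl C2 C1 X' X) => //; first exact: Y_configC.
  - by rewrite [C2 :|: C1]setUC.
  - by rewrite setIC.
  - by rewrite setIC.
have [_ dis [c1 c2 _] cfg] := cfg0.
have [b b2 b1] : exists2 b, b \in C2 & b \notin C1.
  apply/subsetPn/negP => /setIidPr e2'.
  by move: r2; rewrite -c2 -e2' e12 cards1.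
have eb : e != b by apply: contraNneq b1 => <-.
(* I has r elements in X', like C2, yet it is independent over K.             *)
pose I := b |: C1 :\ e.
have IC : I \subset C1 :|: C2.
  rewrite subUset sub1set inE b2 orbT.
  exact: subset_trans (subsetDl _ _) (subsetUl _ _).
have cI : #|I| = r.
  by rewrite cardsU1 !inE (negPf b1) andbF -c1 (cardsD1 e C1) e1.
have nI1 : ~~ (C1 \subset I).
  by apply/negP => /subsetP/(_ e e1); rewrite !inE eqxx (negPf eb).
have nI2 : ~~ (C2 \subset I).
  apply/negP => /subsetP C2I.
  have : C2 \subset [set b].
    apply/subsetP => x x2; have := C2I x x2; rewrite !inE.
    case/orP => [//|/andP[xe x1]]; move: xe.
    by have := in_set1 x e; rewrite -e12 inE x1 x2 => <-.
  by move/subset_leq_card; rewrite c2 cards1 leqNgt (ltnW r2).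
(* The load on [X'] depends on [L] only through its size, so [I :|: K] exceeds the capacity just as
   [C2 :|: K] does. *)
have count (L : {set T}) :
    L \subset C1 :|: C2 -> g @: L \subset X' -> #|L| = r ->
    #|g @: (L :|: K) :&: X'| = r + #|g @: K :&: X'|.
  move=> LC LX cL.
  have LE : L \subset ground M.
    by apply: subset_trans LC (subset_trans (subsetUr K _) sE).
  have KE : K \subset ground M := subset_trans (subsetUl _ _) sE.
  have gLK : g @: L :&: g @: K = set0.
    apply/setP => z; rewrite in_set0; apply/negP => /setIP[/imsetP[x xL ->]].
    case/imsetP => y yK /(gi _ _ (subsetP LE x xL) (subsetP KE y yK)) xy.
    by have /pred0P/(_ y) := dis; rewrite /= yK (subsetP LC) // -xy.
  rewrite imsetU setIUl (setIidPl LX) cardsU setIA gLK set0I cards0 subn0.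
  rewrite card_in_imset ?cL // => x y /(subsetP LE) xE /(subsetP LE).
  exact: gi.
have IX : g @: I \subset X'.
  rewrite imsetU imset_set1 subUset sub1set (subsetP X2) ?imset_f //=.
  apply: subset_trans (subset_trans X1 XX'); exact/imsetS/subsetDl.
have : I :|: K \in indep M by rewrite cfg // cI leqnn nI1.
rewrite gIc; last first.
  by apply: subset_trans sE; rewrite setUC setUS.
move=> /forall_inP/(_ X' XA'); rewrite leqNgt count //.
by rewrite -(count C2) ?subsetUr // cX'.
Qed.

Theorem theorem1p2 (T : finType) (M : matroid T) :
  laminar M <-> ~ (exists (r : nat) (r3 : 3 <= r), has_minor M (Y r3)).
Proof.
split=> [lamM [r [r3 /minor_Y_config[K [C1 [C2 cfg]]]]]|noY].
  exact: laminar_Y_config r3 lamM cfg.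
have nestM : nested_circuits M.
  move=> C1 C2 c1 c2 meet; apply/orP; apply: contraT => /norP[n12 n21].
  have /crossingP/crossing_minor : crossingb M C1 C2.
    by rewrite /crossingb c1 c2 meet n12.
  case=> r [K [D1 [D2 [r3 cfg]]]]; case: noY.
  by exists r, r3; apply: Y_config_minor cfg.
exists T, (ground M), (flat_family M), (rk M), (flat_family_laminar nestM).
split; first exact: flat_family_ground.
apply: (isomorphic_inj (g := id)) => [x y _ _ //||I _]; first exact: imset_id.
by rewrite imset_id flat_family_indep.
Qed.
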